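(* Let $p>2$ be a prime, let $\mathbb{K}$ be a field of characteristic $p$, let $n>1$ and $m\ge 1$ be integers, and let $SL^{n,m}$ be the Lie superalgebra over $\mathbb{K}$ defined in the context. Then $SL^{n,m}$ has a $[p|2p]$-structure (i.e. is restricted) if and only if $m\le p$ and $n\le p+1$.
   Context: The Lie superalgebra $SL^{n,m}$. Its even part has basis $X_1,\dots,X_n,T_1,T_2,T_3$ and its odd part has basis $Y_1,\dots,Y_m$. The only non-zero brackets of basis elements (up to the super skew-symmetry $[X,Y]=-(-1)^{|X||Y|}[Y,X]$) are - $[X_1,X_i]=X_{i+1}$ for $2\le i\le n-1$; $[X_1,Y_j]=Y_{j+1}$ for $1\le j\le m-1$; - $[T_1,X_i]=iX_i$ for $1\le i\le n$; $[T_1,Y_j]=jY_j$ for $1\le j\le m$; - $[T_2,X_i]=X_i$ for $2\le i\le n$; $[T_3,Y_j]=Y_j$ for $1\le j\le m$. In particular the bracket of any two odd elements is zero. Integer coefficients are read in $\mathbb{K}$. Restricted structure. A Lie superalgebra $\mathfrak g=\mathfrak g_{\bar 0}\oplus\mathfrak g_{\bar 1}$ over a field of characteristic $p>2$ has a $[p|2p]$-structure if there is a map $[p]:\mathfrak g_{\bar 0}\to\mathfrak g_{\bar 0}$, $a\mapsto a^{[p]}$, such that (SR1) $\mathrm{ad}_{a^{[p]}}(b)=(\mathrm{ad}_a)^p(b)$ for all $a\in\mathfrak g_{\bar 0}$, $b\in\mathfrak g$; (SR2) $(\alpha a)^{[p]}=\alpha^p a^{[p]}$ for all $a\in\mathfrak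 g_{\bar 0}$, $\alpha\in\mathbb{K}$; (SR3) $(a+b)^{[p]}=a^{[p]}+b^{[p]}+\sum_{1\le i\le p-1}s_i(a,b)$ for all $a,b\in\mathfrak g_{\bar 0}$, where the $s_i(a,b)$ are obtained from $(\mathrm{ad}_{\lambda a+b})^{p-1}(a)=\sum_{1\le i\le p-1} i\,s_i(a,b)\lambda^{i-1}$ ($\lambda$ an indeterminate). One then sets $[2p]:\mathfrak g_{\bar 1}\to\mathfrak g_{\bar 0}$, $a\mapsto (a^2)^{[p]}$, where $a^2=\tfrac12[a,a]$ is the squaring whose polarization is the bracket of odd elements. The pair $(\mathfrak g,[p|2p])$ is called a restricted Lie superalgebra. *)

(* Defs.v *)
From HB Require Import structures.
From mathcomp Require Import all_boot all_order all_algebra.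
From mathcomp Require Import ring.
Set Implicit Arguments.
Unset Strict Implicit.
Unset Printing Implicit Defensive.
Import GRing.Theory.
Local Open Scope ring_scope.

(* V0 is the even part and V1 the odd part; [true] is the odd parity. *)
Definition homog (K : fieldType) (V0 V1 : lmodType K) (b : bool)
    (x : V0 * V1) : Prop :=
  if b then x.1 = 0 else x.2 = 0.

(* Meant for fields of characteristic different from 2. The axiom lie_odd3 is *)
(* a consequence of lie_jacobi except in characteristic 3, where it is part   *)
(* of the usual definition.                                                   *)
Record lieSuperalg (K : fieldType) := LieSuperalg {
  lie_ev : lmodType K;
  lie_od : lmodType K;
  lie_br : lie_ev * lie_od -> lie_ev * lie_od -> lie_ev * lie_od;
  lie_linearr : forall x, linear (lie_br x);
  lie_linearl : forall y, linear (lie_br^~ y);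
  lie_graded : forall b c x y, homog b x -> homog c y ->
    homog (b (+) c) (lie_br x y);
  lie_skew : forall b c x y, homog b x -> homog c y ->
    lie_br x y = - ((-1) ^+ (b && c) *: lie_br y x);
  lie_jacobi : forall b c x y z, homog b x -> homog c y ->
    lie_br x (lie_br y z) =
      lie_br (lie_br x y) z + (-1) ^+ (b && c) *: lie_br y (lie_br x z);
  lie_odd3 : forall x, homog true x -> lie_br x (lie_br x x) = 0
}.

Section Restricted.
Variables (K : fieldType) (g : lieSuperalg K).
Implicit Types a b : lie_ev g.

Definition ev_in a : lie_ev g * lie_od g := (a, 0).
Definition od_in (y : lie_od g) : lie_ev g * lie_od g := (0, y).

Definition ev_br a b : lie_ev g := (lie_br (ev_in a) (ev_in b)).1.

Definition od_sqr (y : lie_od g) : lie_ev g :=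
  2%:R^-1 *: (lie_br (od_in y) (od_in y)).1.

(* A polynomial in an indeterminate lambda with coefficients in the even part *)
(* is encoded by its coefficient function [nat -> lie_ev g]; [pol_br] is the  *)
(* lambda-bilinear extension of the bracket.                                  *)
Definition pol_br (u v : nat -> lie_ev g) : nat -> lie_ev g :=
  fun k => \sum_(i < k.+1) ev_br (u i) (v (k - i)%N).

Definition pol_const a : nat -> lie_ev g :=
  fun k => if k is 0%N then a else 0.

(* lambda a + b *)
Definition pol_lin a b : nat -> lie_ev g :=
  fun k => match k with 0%N => b | 1%N => a | _ => 0 end.

(* i s_i(a,b) is the coefficient of lambda^(i-1) in                           *)
(* (ad_(lambda a + b))^(p-1) (a); i is invertible in K for 1 <= i <= p-1.     *)
Definition jacobson_s (p i : nat) a b : lie_ev g :=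
  i%:R^-1 *: iter p.-1 (pol_br (pol_lin a b)) (pol_const a) i.-1.

Record is_p2p_structure (p : nat) (pmap : lie_ev g -> lie_ev g)
    (p2map : lie_od g -> lie_ev g) : Prop := IsP2pStructure {
  SR1 : forall a x,
    lie_br (ev_in (pmap a)) x = iter p (lie_br (ev_in a)) x;
  SR2 : forall (c : K) a, pmap (c *: a) = c ^+ p *: pmap a;
  SR3 : forall a b,
    pmap (a + b) = pmap a + pmap b + \sum_(1 <= i < p) jacobson_s p i a b;
  p2mapE : forall y, p2map y = pmap (od_sqr y)
}.

Definition has_p2p_structure (p : nat) : Prop :=
  exists pmap p2map, is_p2p_structure p pmap p2map.

End Restricted.

Section SL.
Variables (K : fieldType) (n m : nat).

Definition sl_ev : lmodType K := ('rV[K]_n * 'rV[K]_3)%type.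
Definition sl_od : lmodType K := 'rV[K]_m.

(* One-based numbering; these vanish when k is out of range, e.g. slX n.+1.   *)
Definition slX (k : nat) : sl_ev * sl_od :=
  ((\row_(i < n) (i.+1 == k)%:R, 0), 0).
Definition slT (k : nat) : sl_ev * sl_od :=
  ((0, \row_(i < 3) (i.+1 == k)%:R), 0).
Definition slY (k : nat) : sl_ev * sl_od :=
  (0, \row_(j < m) (j.+1 == k)%:R).

(* Labels of the basis; with i counted from 0, LX i stands for X_(i+1), etc.  *)
Definition sl_label : finType := ('I_n + 'I_3 + 'I_m)%type.
Local Notation LX i := (inl (inl i)).
Local Notation LT k := (inl (inr k)).
Local Notation LY j := (inr j).

Definition sl_basis (a : sl_label) : sl_ev * sl_od :=
  match a with
  | LX i => slX i.+1
  | LT k => slT k.+1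
  | LY j => slY j.+1
  end.

Definition sl_coord (u : sl_ev * sl_od) (a : sl_label) : K :=
  match a with
  | LX i => u.1.1 0 i
  | LT k => u.1.2 0 k
  | LY j => u.2 0 j
  end.

(* The listed brackets, 0 for the pairs in the opposite order.                *)
Definition sl_rel (a b : sl_label) : sl_ev * sl_od :=
  match a, b with
  | LX i, LX j =>
      if (i.+1 == 1)%N && (2 <= j.+1)%N then slX j.+2 else 0
  | LX i, LY j => if (i.+1 == 1)%N then slY j.+2 else 0
  | LT k, LX i =>
      match k.+1 with
      | 1%N => i.+1%:R *: slX i.+1
      | 2%N => if (2 <= i.+1)%N then slX i.+1 else 0
      | _ => 0
      end
  | LT k, LY j =>
      match k.+1 with
      | 1%N => j.+1%:R *: slY j.+1
      | 3%N => slY j.+1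
      | _ => 0
      end
  | _, _ => 0
  end.

(* No bracket of two odd basis elements is listed, so super skew-symmetry     *)
(* only involves the sign -1.                                                 *)
Definition sl_tab (a b : sl_label) : sl_ev * sl_od := sl_rel a b - sl_rel b a.

Definition sl_br (u v : sl_ev * sl_od) : sl_ev * sl_od :=
  \sum_a \sum_b (sl_coord u a * sl_coord v b) *: sl_tab a b.

Lemma sum_label (V : nmodType) (F : sl_label -> V) :
  \sum_a F a = \sum_i F (LX i) + \sum_k F (LT k) + \sum_j F (LY j).
Proof. by rewrite /sl_label big_sumType /= big_sumType. Qed.

Lemma sl_coord0 a : sl_coord 0 a = 0.
Proof. by case: a => [[i|k]|j] /=; rewrite mxE. Qed.
Lemma sl_coordD u v a : sl_coord (u + v) a = sl_coord u a + sl_coord v a.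
Proof. by case: a => [[i|k]|j] /=; rewrite mxE. Qed.
Lemma sl_coordN u a : sl_coord (- u) a = - sl_coord u a.
Proof. by case: a => [[i|k]|j] /=; rewrite mxE. Qed.
Lemma sl_coordZ c u a : sl_coord (c *: u) a = c * sl_coord u a.
Proof. by case: a => [[i|k]|j] /=; rewrite mxE. Qed.
Lemma sl_coord_sum (I : finType) (F : I -> sl_ev * sl_od) a :
  sl_coord (\sum_i F i) a = \sum_i sl_coord (F i) a.
Proof.
exact: (big_morph (sl_coord^~ a) (fun u v => sl_coordD u v a) (sl_coord0 a)).
Qed.

Lemma sl_coordP u v : (forall a, sl_coord u a = sl_coord v a) -> u = v.
Proof.
case: u v => [[ux ut] uy] [[vx vt] vy] h; congr (_, _, _).
- by apply/rowP => i; exact: h (LX i).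
- by apply/rowP => i; exact: h (LT i).
- by apply/rowP => i; exact: h (LY i).
Qed.

Lemma sl_coord_basis a b : sl_coord (sl_basis a) b = (a == b)%:R.
Proof.
by case: a b => [[i|k]|j] [[i'|k']|j'] /=; rewrite !mxE ?eqSS // eq_sym.
Qed.

Lemma sl_br_basis a b : sl_br (sl_basis a) (sl_basis b) = sl_tab a b.
Proof.
rewrite /sl_br (bigD1 a) //= [X in _ + X]big1 ?addr0 => [|a' nea]; last first.
  apply: big1 => b' _; rewrite sl_coord_basis eq_sym (negPf nea).
  by rewrite mul0r scale0r.
rewrite (bigD1 b) //= [X in _ + X]big1 ?addr0 => [|b' neb]; last first.
  by rewrite !sl_coord_basis [b == _]eq_sym (negPf neb) mulr0 scale0r.
by rewrite !sl_coord_basis !eqxx mulr1 scale1r.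
Qed.

(* Coordinates with the one-based numbering, 0 out of range.                  *)
Definition cX (u : sl_ev * sl_od) (k : nat) : K :=
  \sum_(i < n) (i.+1 == k)%:R * u.1.1 0 i.
Definition cT (u : sl_ev * sl_od) (k : nat) : K :=
  \sum_(i < 3) (i.+1 == k)%:R * u.1.2 0 i.
Definition cY (u : sl_ev * sl_od) (k : nat) : K :=
  \sum_(i < m) (i.+1 == k)%:R * u.2 0 i.

Lemma delta_sum N (f : 'I_N -> K) (i : 'I_N) :
  \sum_(j < N) (j.+1 == i.+1)%:R * f j = f i.
Proof.
rewrite (bigD1 i) //= eqxx mul1r big1 ?addr0 // => j ne.
by rewrite eqSS (inj_eq val_inj) (negPf ne) mul0r.
Qed.

Lemma cXE (u : sl_ev * sl_od) (i : 'I_n) : u.1.1 0 i = cX u i.+1.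
Proof. by rewrite /cX delta_sum. Qed.
Lemma cTE (u : sl_ev * sl_od) (i : 'I_3) : u.1.2 0 i = cT u i.+1.
Proof. by rewrite /cT delta_sum. Qed.
Lemma cYE (u : sl_ev * sl_od) (i : 'I_m) : u.2 0 i = cY u i.+1.
Proof. by rewrite /cY delta_sum. Qed.

(* Bilinear extension of sl_rel. *)
Definition sl_half (u v : sl_ev * sl_od) : sl_ev * sl_od :=
  \sum_a \sum_b (sl_coord u a * sl_coord v b) *: sl_rel a b.

Lemma sl_brE u v : sl_br u v = sl_half u v - sl_half v u.
Proof.
rewrite /sl_half [X in _ - X]exchange_big -sumrB /=; apply: eq_bigr => a _.
rewrite -sumrB; apply: eq_bigr => b _.
by rewrite /sl_tab scalerBr [sl_coord v b * _]mulrC.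
Qed.

Lemma half_coord u v c : sl_coord (sl_half u v) c =
  \sum_a \sum_b sl_coord u a * sl_coord v b * sl_coord (sl_rel a b) c.
Proof.
rewrite sl_coord_sum; apply: eq_bigr => a _.
by rewrite sl_coord_sum; apply: eq_bigr => b _; rewrite sl_coordZ.
Qed.


Lemma halfX u v (k : 'I_n) : sl_coord (sl_half u v) (LX k) =
  cX u 1 * ((2 <= k)%N%:R * cX v k)
  + (cT u 1 * k.+1%:R + cT u 2 * (1 <= k)%N%:R) * cX v k.+1.
Proof.
rewrite half_coord !sum_label [X in _ + X]big1 ?addr0; last first.
  by move=> j _; apply: big1 => -[[]|] *; rewrite sl_coord0 mulr0.
congr (_ + _).
  rewrite /cX mulr_suml; apply: eq_bigr => i _.
  rewrite sum_label [X in _ + X]big1 ?addr0 => [|j _]; last first.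
    by rewrite /=; case: ifP; rewrite mxE mulr0.
  rewrite [X in _ + X]big1 ?addr0 => [|j _]; last by rewrite /= mxE mulr0.
  rewrite !mulr_sumr; apply: eq_bigr => j _ /=; case: (i.+1 == 1%N) => /=.
    case: ifP => hj; rewrite !mxE; last first.
      by case: eqP => [<-|_]; rewrite ?hj /=; ring.
    by rewrite eqSS eq_sym; case: eqP => [<-|_]; rewrite ?hj /=; ring.
  by rewrite mxE; ring.
rewrite !big_ord_recl big_ord0 addr0 [X in _ + (_ + X)]big1; last first.
  by move=> [[i|i]|i] _ /=; rewrite mxE mulr0.
rewrite addr0 mulrDl; congr (_ + _).
  rewrite sum_label [X in _ + _ + X]big1 => [|j _]; last by rewrite /= !mxE !mulr0.
  rewrite [X in _ + X + _]big1 ?addr0 => [|j _]; last by rewrite /= mxE mulr0.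
  rewrite -(cTE u ord0) -cXE.
  rewrite (eq_bigr (fun j : 'I_n => (j.+1 == k.+1)%:R *
    (u.1.2 0 ord0 * j.+1%:R * v.1.1 0 j)));
    rewrite ?delta_sum // => j _ /=.
  by rewrite !mxE [k.+1 == _]eq_sym; ring.
rewrite sum_label [X in _ + _ + X]big1 => [|j _]; last by rewrite /= !mxE !mulr0.
rewrite [X in _ + X + _]big1 ?addr0 => [|j _]; last by rewrite /= mxE mulr0.
rewrite -(cTE u (lift ord0 ord0)) -cXE.
rewrite (eq_bigr (fun j : 'I_n => (j.+1 == k.+1)%:R *
  (u.1.2 0 (lift ord0 ord0) * (1 <= j)%N%:R * v.1.1 0 j)));
  rewrite ?delta_sum // => j _ /=.
rewrite -[(0 < j)%N]/(1 < j.+1)%N.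
by case: ifP => hj; rewrite !mxE ?[k.+1 == _]eq_sym /=; ring.
Qed.

Lemma halfY u v (k : 'I_m) : sl_coord (sl_half u v) (LY k) =
  cX u 1 * cY v k + (cT u 1 * k.+1%:R + cT u 3) * cY v k.+1.
Proof.
rewrite half_coord !sum_label [X in _ + X]big1 ?addr0; last first.
  by move=> j _; apply: big1 => -[[]|] *; rewrite sl_coord0 mulr0.
congr (_ + _).
  rewrite [cX _ _]/cX /cY mulr_suml; apply: eq_bigr => i _.
  rewrite sum_label big1 ?add0r => [|j _]; last first.
    by rewrite /=; case: ifP; rewrite mxE mulr0.
  rewrite big1 ?add0r => [|j _]; last by rewrite /= mxE mulr0.
  rewrite !mulr_sumr; apply: eq_bigr => j _ /=; case: (i.+1 == 1%N) => /=.
    by rewrite mxE eqSS eq_sym; ring.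
  by rewrite mxE; ring.
rewrite !big_ord_recl big_ord0 addr0 [X in _ + (X + _)]big1; last first.
  by move=> [[i|i]|i] _ /=;
     try case: ifP; rewrite !mxE mulr0.
rewrite add0r mulrDl; congr (_ + _).
  rewrite sum_label big1 ?add0r => [|j _]; last by rewrite /= !mxE !mulr0.
  rewrite big1 ?add0r => [|j _]; last by rewrite /= mxE mulr0.
  rewrite -(cTE u ord0) -cYE.
  rewrite (eq_bigr (fun j : 'I_m => (j.+1 == k.+1)%:R *
    (u.1.2 0 ord0 * j.+1%:R * v.2 0 j)));
    rewrite ?delta_sum // => j _ /=.
  by rewrite !mxE [k.+1 == _]eq_sym; ring.
rewrite sum_label big1 ?add0r => [|j _]; last by rewrite /= !mxE !mulr0.
rewrite big1 ?add0r => [|j _]; last by rewrite /= mxE mulr0.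
rewrite -(cTE u (lift ord0 (lift ord0 ord0))) -cYE.
rewrite (eq_bigr (fun j : 'I_m => (j.+1 == k.+1)%:R *
  (u.1.2 0 (lift ord0 (lift ord0 ord0)) * v.2 0 j)));
  rewrite ?delta_sum // => j _ /=.
by rewrite !mxE [k.+1 == _]eq_sym; ring.
Qed.

Lemma halfT u v (k : 'I_3) : sl_coord (sl_half u v) (LT k) = 0.
Proof.
rewrite half_coord; apply: big1 => a _; apply: big1 => b _.
suff -> : sl_coord (sl_rel a b) (LT k) = 0 by rewrite mulr0.
case: a b => [[i|[[|[|[|i]]] hi]]|i] [[j|j]|j] //=;
  by try case: ifP; rewrite ?mxE ?mulr0.
Qed.

Lemma cX_br u v (k : nat) : (k <= n)%N || (k == 1)%N -> cX (sl_br u v) k =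
  cX u 1 * ((3 <= k)%N%:R * cX v k.-1)
  + (cT u 1 * k%:R + cT u 2 * (2 <= k)%N%:R) * cX v k
  - (cX v 1 * ((3 <= k)%N%:R * cX u k.-1)
  + (cT v 1 * k%:R + cT v 2 * (2 <= k)%N%:R) * cX u k).
Proof.
case: k => [_|k hk].
  have c0 w : cX w 0 = 0 by apply: big1 => i _; rewrite mul0r.
  by rewrite !c0 /=; ring.
have [hkn|hkn] := ltnP k n.
  rewrite -(cXE _ (Ordinal hkn)) -[LHS]/(sl_coord _ (LX (Ordinal hkn))) sl_brE.
  by rewrite sl_coordD sl_coordN !halfX.
have c0 w : cX w k.+1 = 0.
  apply: big1 => i _; rewrite eqSS; case: eqP => [ik|]; last by rewrite mul0r.
  by move: (ltn_ord i); rewrite ik ltnNge hkn.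
have k0 : k = 0%N by move: hk; rewrite ltnNge hkn /= => /eqP [].
by rewrite !c0 k0 /=; ring.
Qed.

Lemma cY_br u v (k : nat) : (k <= m)%N -> cY (sl_br u v) k =
  cX u 1 * cY v k.-1 + (cT u 1 * k%:R + cT u 3) * cY v k
  - (cX v 1 * cY u k.-1 + (cT v 1 * k%:R + cT v 3) * cY u k).
Proof.
case: k => [_|k hk].
  have c0 w : cY w 0 = 0 by apply: big1 => i _; rewrite mul0r.
  by rewrite !c0 /=; ring.
rewrite -(cYE _ (Ordinal hk)) -[LHS]/(sl_coord _ (LY (Ordinal hk))) sl_brE.
by rewrite sl_coordD sl_coordN !halfY.
Qed.

Lemma cT_br u v (k : nat) : cT (sl_br u v) k = 0.
Proof.
apply: big1 => i _; rewrite -[(sl_br u v).1.2 0 i]/(sl_coord (sl_br u v) (LT i)) sl_brE.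
by rewrite sl_coordD sl_coordN !halfT subrr mulr0.
Qed.

Lemma sl_br_anti u v : sl_br u v = - sl_br v u.
Proof. by rewrite !sl_brE opprB. Qed.

Lemma sl_br_linearr u : linear (sl_br u).
Proof.
move=> c v w; rewrite /sl_br scaler_sumr -big_split; apply: eq_bigr => a _ /=.
rewrite scaler_sumr -big_split; apply: eq_bigr => b _ /=.
by rewrite sl_coordD sl_coordZ scalerA -scalerDl; congr (_ *: _); ring.
Qed.

Lemma sl_br_linearl v : linear (sl_br^~ v).
Proof.
by move=> c u w /=; rewrite !(sl_br_anti _ v) sl_br_linearr scalerN opprD.
Qed.

Lemma sl_br_leibniz u v w :
  sl_br u (sl_br v w) = sl_br (sl_br u v) w + sl_br v (sl_br u w).
Proof.
apply: sl_coordP => -[[k|k]|k]; rewrite sl_coordD /= ?cXE ?cYE ?cTE.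
- have hk : (k < n)%N by [].
  have hk' : (k <= n)%N by exact: ltnW.
  case: (nat_of_ord k) hk hk' => [|[|[|j]]] hk hk';
    rewrite !(cX_br, cT_br) ?hk ?hk' ?orbT //=; ring.
- by rewrite !cT_br addr0.
have hk : (k < m)%N by [].
have hk' : (k <= m)%N by exact: ltnW.
rewrite !(cY_br, cX_br, cT_br) ?hk ?hk' ?orbT //=.
by case: (nat_of_ord k) => [|j] /=; ring.
Qed.

Lemma cX_od w k : w.1 = 0 -> cX w k = 0.
Proof. by move=> w0; apply: big1 => i _; rewrite w0 mxE mulr0. Qed.

Lemma cT_od w k : w.1 = 0 -> cT w k = 0.
Proof. by move=> w0; apply: big1 => i _; rewrite w0 mxE mulr0. Qed.

Lemma cY_ev w k : w.2 = 0 -> cY w k = 0.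
Proof. by move=> w0; apply: big1 => i _; rewrite w0 mxE mulr0. Qed.

Lemma sl_br_odd u v : u.1 = 0 -> v.1 = 0 -> sl_br u v = 0.
Proof.
move=> u0 v0; apply: sl_coordP => -[[k|k]|k]; rewrite sl_coord0 /=.
- by rewrite cXE cX_br ?ltn_ord // !(cX_od _ u0, cX_od _ v0); ring.
- by rewrite cTE cT_br.
- rewrite cYE cY_br // !(cX_od _ u0, cX_od _ v0) !(cT_od _ u0, cT_od _ v0).
  by ring.
Qed.

Lemma sl_br_ideal u v : v.1 = 0 -> (sl_br u v).1 = 0.
Proof.
move=> v0; suff: forall a, (if a is LY _ then false else true) ->
    sl_coord (sl_br u v) a = 0.
  case: (sl_br u v) => [[x t] y] h /=; congr (_, _); apply/rowP => i.
    by rewrite mxE; exact: (h (LX i)).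
  by rewrite mxE; exact: (h (LT i)).
case=> [[k|k]|k] //= _; last by rewrite cTE cT_br.
by rewrite cXE cX_br ?ltn_ord // !(cX_od _ v0, cT_od _ v0); ring.
Qed.

Lemma sl_br_graded b c u v : homog b u -> homog c v ->
  homog (b (+) c) (sl_br u v).
Proof.
case: b c => [] [] /= hu hv.
- by rewrite sl_br_odd.
- by rewrite sl_br_anti /= sl_br_ideal ?oppr0.
- by rewrite sl_br_ideal.
- by apply/rowP => k; rewrite cYE cY_br // !(cY_ev _ hu, cY_ev _ hv) mxE; ring.
Qed.

Lemma sl_br_skew b c u v : homog b u -> homog c v ->
  sl_br u v = - ((-1) ^+ (b && c) *: sl_br v u).
Proof.
case: b c => [] [] /= hu hv; rewrite ?scale1r; try exact: sl_br_anti.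
by rewrite !sl_br_odd // scaler0 oppr0.
Qed.

Lemma sl_br0 u : sl_br u 0 = 0.
Proof.
by have := sl_br_linearr u (-1) 0 0; rewrite scaler0 addr0 scaleN1r addNr.
Qed.

Lemma sl_br_jacobi b c u v w : homog b u -> homog c v ->
  sl_br u (sl_br v w) =
    sl_br (sl_br u v) w + (-1) ^+ (b && c) *: sl_br v (sl_br u w).
Proof.
case: b c => [] [] /= hu hv; rewrite ?scale1r; try exact: sl_br_leibniz.
rewrite sl_br_leibniz ![sl_br v (sl_br u w)]sl_br_odd ?scaler0 //.
by rewrite sl_br_anti /= sl_br_ideal ?oppr0.
Qed.

Lemma sl_br_odd3 u : homog true u -> sl_br u (sl_br u u) = 0.
Proof. by move=> hu; rewrite [sl_br u u]sl_br_odd // sl_br0. Qed.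

Definition SL : lieSuperalg K :=
  LieSuperalg sl_br_linearr sl_br_linearl sl_br_graded sl_br_skew sl_br_jacobi
    sl_br_odd3.

End SL.

(* Main.v *)
Require Import Defs.
From HB Require Import structures.
From mathcomp Require Import all_boot all_order all_algebra.
From mathcomp Require Import ring.
Import GRing.Theory.
Local Open Scope ring_scope.

Set Implicit Arguments.
Unset Strict Implicit.
Unset Printing Implicit Defensive.

(** Let ad be the adjoint action of the even part on the whole superalgebra.

    Necessity. If X_1 has a p-th power z, then ad z = (ad X_1)^p. When m > p,
    the right-hand side sends Y_1 to Y_(p+1), and when n > p + 1 it sends X_2
    to X_(p+2) ([iter_ad_slX1_slY1], [iter_ad_slX1_slX2]). But one bracket with
    an even element moves Y_1 and X_2 by at most one place, and p > 1.

    Sufficiency. No nonzero even element acts by zero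
    ([sl_even_centralizer]), so ad embeds the even part in the associative
    algebra of endomorphisms, and a^[p] can only be the element, if there is
    one, whose adjoint is (ad a)^p. If every a has such an element, the axioms
    follow: SR1 by definition, SR2 by injectivity, and SR3 from Jacobson's
    identity in an associative algebra of characteristic p
    ([jacobson_formula]):
      (x + y)^p = x^p + y^p + sum_i s_i(x, y).
    The same identity shows that the elements a that have a p-th power are
    closed under addition, because the s_i are Lie polynomials. It is then
    enough to treat the three summands of
      a = c X_1 + (combination of X_2, ..., X_n) + (combination of the T_i).
    The adjoint of the first raises all indices by one, so its p-th power
    vanishes under the stated bounds; the adjoint of the second squares
    to zero; that of the third is diagonal, with eigenvalues linear over the
    prime field in the coefficients of the T_i, so Frobenius gives its p-th
    power ([p2p_criterion], [restrictable_X1], [restrictable_X2],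
    [restrictable_T]). *)

(** * Jacobson's identity in characteristic p *)

Definition comm_br (R : pzRingType) (x y : R) : R := x * y - y * x.

(** The coefficient of t^i in (1 - t)^k. *)
Definition sbin (k i : nat) : int := (-1) ^+ i * 'C(k, i)%:Z.

Lemma sbinS k i : sbin k.+1 i.+1 = sbin k i.+1 - sbin k i.
Proof.
by rewrite /sbin binS PoszD mulrDr [in X in _ + X]exprS mulN1r mulNr.
Qed.

(** Left and right multiplication by l commute, so this is the binomial formula
    for the k-th power of their difference. *)
Lemma iter_comm_br (R : pzRingType) (l x : R) (k : nat) :
  iter k (comm_br l) x =
    \sum_(i < k.+1) (l ^+ (k - i) * x * l ^+ i) *~ sbin k i.
Proof.
elim: k => [|k IH].
  by rewrite big_ord_recl big_ord0 /sbin /= !expr0 mul1r !mulr1 addr0.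
rewrite iterS {}IH /comm_br mulr_sumr mulr_suml big_ord_recl.
rewrite -addrA [RHS]big_ord_recl; congr (_ + _).
  by rewrite /sbin !bin0 !subn0 !mulrzAr !mulrA -exprS.
rewrite [RHS](eq_bigr (fun i : 'I_k.+1 =>
    (l ^+ (k - i) * x * l ^+ i.+1) *~ sbin k i.+1
    - (l ^+ (k - i) * x * l ^+ i.+1) *~ sbin k i)); last first.
  by move=> i _; rewrite lift0 subSS sbinS mulrzBr.
rewrite sumrB; congr (_ - _).
  have top0 : sbin k k.+1 = 0 by rewrite /sbin bin_small ?mulr0.
  rewrite [RHS]big_ord_recr /= top0 mulr0z addr0.
  apply: eq_bigr => i _.
  rewrite mulrzAr !mulrA -exprS /= /bump add1n subnS prednK //.
  by rewrite subn_gt0.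
by apply: eq_bigr => i _; rewrite mulrzAl -mulrA -exprSr.
Qed.

(** In characteristic p, (1 - t)^(p-1) = (1 - t^p) / (1 - t), that is,
    1 + t + ... + t^(p-1). Coefficientwise this is Pascal's rule, since p
    divides the inner binomial coefficients of p. *)
Lemma sbin_pred_pchar (R : pzRingType) (p i : nat) (z : R) :
  prime p -> z *+ p = 0 -> (i < p)%N -> z *~ sbin p.-1 i = z.
Proof.
move=> p_pr zp; elim: i => [|i IH] ltip; first by rewrite /sbin bin0.
have /eqP := sbinS p.-1 i; rewrite (prednK (prime_gt0 p_pr)) eq_sym subr_eq.
move=> /eqP ->; rewrite mulrzDr IH ?(ltnW ltip) //.
suff -> : z *~ sbin p i.+1 = 0 by rewrite add0r.
have /dvdnP [q binE] : (p %| 'C(p, i.+1))%N by rewrite prime_dvd_bin.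
by rewrite /sbin binE PoszM mulrA mulrC mulrzA -[z *~ p%:Z]/(z *+ p) zp mul0rz.
Qed.

Lemma deriv_linX (R : nzRingType) (x y : R) (k : nat) :
  let l := x%:P * 'X + y%:P in
  (l ^+ k.+1)^`() = \sum_(i < k.+1) l ^+ (k - i) * x%:P * l ^+ i.
Proof.
move=> l; have dl : l^`() = x%:P.
  by rewrite /l derivMXaddC derivC mul0r addr0.
elim: k => [|k IH].
  by rewrite big_ord_recl big_ord0 expr1 dl !expr0 mul1r mulr1 addr0.
rewrite exprS derivM {}IH dl [RHS]big_ord_recr /= subnn expr0 mul1r addrC.
congr (_ + _); rewrite mulr_sumr; apply: eq_bigr => i _.
by rewrite !mulrA -exprS subSn // -ltnS.
Qed.

(** The expansion of the derivative of l^p by the Leibniz rule and that of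
    (ad l)^(p-1) applied to the leading coefficient of l have the same terms,
    since all coefficients of the latter are 1 in characteristic p. *)
Lemma deriv_linX_pchar (R : nzRingType) (p : nat) (x y : R) :
  p \in [pchar R] ->
  let l := x%:P * 'X + y%:P in
  (l ^+ p)^`() = iter p.-1 (comm_br l) x%:P.
Proof.
move=> charR l; have p_pr := pcharf_prime charR.
have {1}-> : p = p.-1.+1 by rewrite prednK ?prime_gt0.
rewrite deriv_linX iter_comm_br; apply: eq_bigr => i _.
rewrite sbin_pred_pchar //.
  by rewrite -mulr_natr -polyC_natr (pcharf0 charR) polyC0 mulr0.
by rewrite -[X in (_ < X)%N](prednK (prime_gt0 p_pr)).
Qed.

Lemma coef_linX_exp (R : nzRingType) (x y : R) (k : nat) :
  let l := x%:P * 'X + y%:P in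
  [/\ (size (l ^+ k) <= k.+1)%N, (l ^+ k)`_k = x ^+ k & (l ^+ k)`_0 = y ^+ k].
Proof.
move=> l.
have coef_l q i : (l * q)`_i = (if i is j.+1 then x * q`_j else 0) + y * q`_i.
  rewrite mulrDl -mulrA coefD !coefCM -commr_polyX coefMX.
  by case: i => [|i] //=; rewrite mulr0.
elim: k => [|k [IHs IHk IH0]].
  by split; rewrite ?expr0 ?size_poly1 ?coef1.
rewrite !exprS !coef_l IHk IH0; split.
- apply/leq_sizeP => -[|j] //= ltkj; rewrite coef_l.
  by rewrite !(leq_sizeP _ _ IHs) ?mulr0 ?addr0 // ltnW.
- by rewrite (leq_sizeP _ _ IHs) ?mulr0 ?addr0.
- by rewrite add0r.
Qed.

(** The polynomial l^p, with l = x X + y, has constant term y^p and leading term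
    x^p X^p. Its other coefficients are recovered from its derivative, their
    degrees being invertible, and evaluation at 1 gives (x + y)^p. *)
Lemma jacobson_formula (K : fieldType) (A : algType K) (p : nat) (x y : A) :
  p \in [pchar K] ->
  (x + y) ^+ p = x ^+ p + y ^+ p + \sum_(1 <= i < p)
    i%:R^-1 *: (iter p.-1 (comm_br (x%:P * 'X + y%:P)) x%:P)`_i.-1.
Proof.
move=> charK; have p_pr := pcharf_prime charK.
have charA : p \in [pchar A] by rewrite pchar_lalg.
rewrite -(deriv_linX_pchar x y charA); set l := x%:P * 'X + y%:P.
have [size_l coef_p coef_0] := coef_linX_exp x y p.
have horner1 q : comm_poly q (1 : A) by rewrite /comm_poly mul1r mulr1.
have -> : x + y = l.[1].
  by rewrite /l hornerD hornerM_comm // !hornerC hornerX mulr1.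
rewrite -horner_exp_comm // (horner_coef_wide _ size_l).
rewrite -(big_mkord xpredT (fun i => (l ^+ p)`_i * 1 ^+ i)).
rewrite big_nat_recr //= big_ltn ?prime_gt0 //=.
rewrite !expr1n !mulr1 coef_p coef_0 addrC addrA; congr (_ + _).
apply: eq_big_nat => -[|i] // /andP [_ ltip].
rewrite expr1n mulr1 coef_deriv -scaler_nat scalerA mulVf ?scale1r //.
by rewrite -(dvdn_pcharf charK) gtnNdvd.
Qed.

(** * Restricted structures from a faithful representation *)

Section Criterion.
Variables (K : fieldType) (g : lieSuperalg K) (A : algType K).
Variable rho : {linear lie_ev g -> A}.
Hypothesis rho_br : forall a b, rho (ev_br a b) = comm_br (rho a) (rho b).

(** The indeterminate is central in a polynomial algebra, so both a bracket of
    coefficient functions and a commutator of polynomials are convolutions. *)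
Lemma rho_pol_br (u v : nat -> lie_ev g) (U V : {poly A}) :
  (forall k, rho (u k) = U`_k) -> (forall k, rho (v k) = V`_k) ->
  forall k, rho (pol_br u v k) = (comm_br U V)`_k.
Proof.
move=> uU vV k; rewrite /comm_br coefB coefM coefMr -sumrB linear_sum.
by apply: eq_bigr => i _; rewrite rho_br uU vV.
Qed.

Lemma rho_jacobson_s (p i : nat) (a b : lie_ev g) :
  rho (jacobson_s p i a b) =
  i%:R^-1 *:
    (iter p.-1 (comm_br ((rho a)%:P * 'X + (rho b)%:P)) (rho a)%:P)`_i.-1.
Proof.
rewrite linearZ; congr (_ *: _); move: i.-1; elim: p.-1 => [|q IH] k /=.
  by rewrite coefC; case: k => [|k] //=; rewrite linear0.
apply: rho_pol_br => // -[|[|k']];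
  by rewrite coefD coefMX !coefC /= ?add0r ?addr0 ?linear0.
Qed.

Variables (p : nat) (charK : p \in [pchar K]).

Lemma rho_add_exp (a b : lie_ev g) :
  rho (a + b) ^+ p =
    rho a ^+ p + rho b ^+ p + rho (\sum_(1 <= i < p) jacobson_s p i a b).
Proof.
rewrite linearD jacobson_formula // linear_sum.
by congr (_ + _); apply: eq_bigr => i _; rewrite rho_jacobson_s.
Qed.

(** The boolean equality lets [xchoose] select the p-th power. *)
Definition rho_restrictable (a : lie_ev g) := exists b, rho b == rho a ^+ p.

Lemma rho_restrictableD a b :
  rho_restrictable a -> rho_restrictable b -> rho_restrictable (a + b).
Proof.
move=> [a' /eqP a'E] [b' /eqP b'E].
exists (a' + b' + \sum_(1 <= i < p) jacobson_s p i a b).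
by rewrite rho_add_exp !linearD /= a'E b'E.
Qed.

(** The algebra acts on the superalgebra through [act], in a way that extends
    the adjoint action of the even part; this is what turns the p-th power
    in the algebra into the p-th iterate required on odd elements as well.
    The other two axioms are checked after applying the injective [rho]. *)
Lemma p2p_criterion (act : A -> lie_ev g * lie_od g -> lie_ev g * lie_od g) :
  (forall x, act 1 x = x) ->
  (forall f h x, act (f * h) x = act f (act h x)) ->
  (forall a x, act (rho a) x = lie_br (ev_in a) x) ->
  injective rho ->
  (forall a, rho_restrictable a) ->
  has_p2p_structure g p.
Proof.
move=> act1 actM act_rho rho_inj restr.
pose pmap a := xchoose (restr a).
have pmapE a : rho (pmap a) = rho a ^+ p by apply/eqP/(xchooseP (restr a)).
exists pmap, (fun y => pmap (od_sqr y)); split=> // [a x|c a|a b].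
- rewrite -act_rho pmapE; elim: p => [|q IH] /=; first by rewrite expr0 act1.
  by rewrite exprS actM IH act_rho.
- by apply: rho_inj; rewrite linearZ !pmapE linearZ exprZn.
- by apply: rho_inj; rewrite 2!linearD !pmapE rho_add_exp.
Qed.

End Criterion.

(** * The algebra of endomorphisms under composition *)

Section Composition.
Variables (K : fieldType) (V : vectType K) (V_proper : (0 < dim V)%N).

(** The product is composition, (f * h) v = f (h v), so that ad is a
    homomorphism and not an anti-homomorphism. *)
Definition comp_nzRing : nzRingType := lfun_comp_nzRingType V_proper.
Definition comp_lalg : lalgType K := HB.pack 'End(V) comp_nzRing
  (GRing.Lmodule_isLalgebra.Build K comp_nzRing
     (fun k f h => comp_lfunZl k f h)).
Definition comp_alg : algType K := HB.pack 'End(V) comp_lalg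
  (GRing.Lalgebra_isAlgebra.Build K comp_lalg
     (fun k f h => comp_lfunZr k f h)).
End Composition.

(** * Coordinates in SL *)

Section SLAdjoint.
Variables (K : fieldType) (n m : nat).
Local Notation V := ('rV[K]_n * 'rV[K]_3 * 'rV[K]_m)%type.
Implicit Types u v w : V.

Lemma slP u v :
  (forall k, (0 < k <= n)%N -> cX u k = cX v k) ->
  (forall k, cT u k = cT v k) ->
  (forall k, (0 < k <= m)%N -> cY u k = cY v k) -> u = v.
Proof.
move=> hX hT hY; apply: sl_coordP => -[[i|i]|i] /=.
- by rewrite !cXE hX //= ltn_ord.
- by rewrite !cTE hT.
- by rewrite !cYE hY //= ltn_ord.
Qed.

Lemma cX0 k : cX (0 : V) k = 0.
Proof. by apply: big1 => i _; rewrite mxE mulr0. Qed.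
Lemma cT0 k : cT (0 : V) k = 0.
Proof. by apply: big1 => i _; rewrite mxE mulr0. Qed.
Lemma cY0 k : cY (0 : V) k = 0.
Proof. by apply: big1 => i _; rewrite mxE mulr0. Qed.

Lemma sum_index (N k : nat) (f : nat -> K) :
  \sum_(i < N) (i.+1 == k)%:R * f i.+1 = (0 < k <= N)%N%:R * f k.
Proof.
have [/andP [k_gt0 lekN]|kN] := boolP (0 < k <= N)%N.
  rewrite -(prednK k_gt0) in lekN *.
  by rewrite (delta_sum (fun i : 'I_N => f i.+1) (Ordinal lekN)) mul1r.
rewrite mul0r big1 // => i _; case: eqP => [ik|]; last by rewrite mul0r.
by move: kN; rewrite -ik /= ltn_ord.
Qed.

Definition in_X (x : nat -> K) : V := ((\row_(i < n) x i.+1, 0), 0).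
Definition in_T (t : nat -> K) : V := ((0, \row_(i < 3) t i.+1), 0).

Lemma cX_in_X x k : cX (in_X x) k = (0 < k <= n)%N%:R * x k.
Proof. by rewrite -sum_index; apply: eq_bigr => i _; rewrite mxE. Qed.
Lemma cT_in_X x k : cT (in_X x) k = 0.
Proof. by apply: big1 => i _; rewrite mxE mulr0. Qed.
Lemma cX_in_T t k : cX (in_T t) k = 0.
Proof. by apply: big1 => i _; rewrite mxE mulr0. Qed.
Lemma cT_in_T t k : cT (in_T t) k = (0 < k <= 3)%N%:R * t k.
Proof. by rewrite -sum_index; apply: eq_bigr => i _; rewrite mxE. Qed.

Lemma cY_in_X x k : cY (in_X x) k = 0.
Proof. exact: cY_ev. Qed.
Lemma cY_in_T t k : cY (in_T t) k = 0.
Proof. exact: cY_ev. Qed.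

Lemma cX_slX j k : cX (slX K n m j) k = (0 < k <= n)%N%:R * (k == j)%:R.
Proof.
rewrite -(sum_index n k (fun k => (k == j)%:R)).
by apply: eq_bigr => i _; rewrite mxE.
Qed.
Lemma cT_slX j k : cT (slX K n m j) k = 0.
Proof. by apply: big1 => i _; rewrite mxE mulr0. Qed.
Lemma cX_slT j k : cX (slT K n m j) k = 0.
Proof. by apply: big1 => i _; rewrite mxE mulr0. Qed.
Lemma cT_slT j k : cT (slT K n m j) k = (0 < k <= 3)%N%:R * (k == j)%:R.
Proof.
rewrite -(sum_index 3 k (fun k => (k == j)%:R)).
by apply: eq_bigr => i _; rewrite mxE.
Qed.
Lemma cY_slX j k : cY (slX K n m j) k = 0.
Proof. exact: cY_ev. Qed.
Lemma cX_slY j k : cX (slY K n m j) k = 0.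
Proof. exact: cX_od. Qed.
Lemma cT_slY j k : cT (slY K n m j) k = 0.
Proof. exact: cT_od. Qed.
Lemma cY_slY j k : cY (slY K n m j) k = (0 < k <= m)%N%:R * (k == j)%:R.
Proof.
rewrite -(sum_index m k (fun k => (k == j)%:R)).
by apply: eq_bigr => i _; rewrite mxE.
Qed.

(** * The adjoint action of the even part *)

(** The brackets with T_1 and T_2 isolate the coordinates on X_1 and on the
    other X_k. Then X_1, X_2 and Y_1 are eigenvectors of what is left of u, and
    their eigenvalues determine the three coordinates on the T_k. *)
Lemma sl_even_centralizer (u : V) : (1 < n)%N -> (0 < m)%N -> u.2 = 0 ->
  (forall v, sl_br u v = 0) -> u = 0.
Proof.
move=> n_gt1 m_gt0 u_ev u0; have n_gt0 := ltnW n_gt1.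
have uY k : cY u k = 0 by exact: cY_ev.
have uX k : (0 < k <= n)%N -> cX u k = 0.
  case/andP=> k_gt0 lekn; case: k k_gt0 lekn => [|[|k]] // _ lekn.
    have := congr1 (fun w => cX w 1) (u0 (slT K n m 1)).
    rewrite cX_br ?lekn // !cX_slT !cT_slT cX0 /= => h.
    by rewrite -[RHS]oppr0 -h; ring.
  have := congr1 (fun w => cX w k.+2) (u0 (slT K n m 2)).
  rewrite cX_br ?lekn // !cX_slT !cT_slT cX0 /= => h.
  by rewrite -[RHS]oppr0 -h; ring.
have uT1 : cT u 1 = 0.
  have := congr1 (fun w => cX w 1) (u0 (slX K n m 1)).
  rewrite cX_br ?n_gt0 // !cX_slX !cT_slX cX0 n_gt0 /= => h.
  by rewrite -[RHS]h; ring.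
have uT2 : cT u 2 = 0.
  have := congr1 (fun w => cX w 2) (u0 (slX K n m 2)).
  rewrite cX_br ?n_gt1 // !cX_slX !cT_slX cX0 n_gt1 uT1 /= => h.
  by rewrite -[RHS]h; ring.
have uT3 : cT u 3 = 0.
  have := congr1 (fun w => cY w 1) (u0 (slY K n m 1)).
  rewrite cY_br // !cY_slY !cX_slY !cT_slY uT1 uX ?n_gt0 // cY0 m_gt0 /= => h.
  by rewrite -[RHS]h; ring.
apply: slP => k; rewrite ?cX0 ?cT0 ?cY0 //; first exact: uX.
case: k => [|[|[|[|k]]]] //; apply: big1 => i _; first by rewrite mul0r.
rewrite eqSS; case: eqP => [ik|]; rewrite ?mul0r //.
by have := ltn_ord i; rewrite ik.
Qed.

(** Two steps are needed to start: the first removes the T-coordinates but may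
    produce X_1 (from T_1), which the second kills. From then on the first
    nonzero X-index, at least 4, and the first nonzero Y-index, at least 3,
    grow by one at each step. *)
Lemma iter_ad_X1 (c : K) v j
    (w := iter j.+2 (sl_br (in_X (fun k => c *+ (k == 1)%N))) v) :
  [/\ forall k, (k <= n)%N -> (k <= j.+3)%N -> cX w k = 0,
      forall k, cT w k = 0 &
      forall k, (k <= m)%N -> (k <= j.+2)%N -> cY w k = 0].
Proof.
rewrite {}/w; set u := in_X _.
have uX k : (k != 1)%N -> cX u k = 0.
  by move=> /negPf k1; rewrite cX_in_X k1 mulr0n mulr0.
have uT k : cT u k = 0 by exact: cT_in_X.
have uY k : cY u k = 0 by exact: cY_in_X.
have adT w k : cT (sl_br u w) k = 0 by exact: cT_br.
have adX w k : (k <= n)%N -> (forall i, cT w i = 0) ->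
    cX (sl_br u w) k = cX u 1 * (2 < k)%N%:R * cX w k.-1.
  move=> lekn wT; rewrite cX_br ?lekn // !wT !uT.
  by case: k lekn => [|[|[|k]]] _ /=; rewrite ?(uX k.+2) //; ring.
have adY w k : (k <= m)%N -> cY (sl_br u w) k = cX u 1 * cY w k.-1.
  by move=> lekm; rewrite cY_br // !uT !uY; ring.
have Y0 w : cY w 0 = 0 by apply: big1 => i _; rewrite mul0r.
split=> [k|k|]; last 2 first.
- by rewrite iterS adT.
- move=> k; move: j.+2 => q; elim: q k => [|q IH] k lekm lekq.
    by move: lekq; rewrite leqn0 => /eqP ->.
  rewrite iterS adY // IH ?mulr0 ?(leq_trans (leq_pred k) lekm) //.
  by case: k lekq {lekm}.
elim: j k => [|j IH] k lekn lekj.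
  have lepn := leq_trans (leq_pred k) lekn.
  rewrite !iterS adX //.
  case: k lekn lekj lepn => [|[|[|[|k]]]] //= lekn _ lepn;
    rewrite ?mulr0 ?mul0r //.
  rewrite cX_br ?lepn // !uT (uX 2) //=; ring.
rewrite iterS adX //; last by move=> i; rewrite iterS adT.
case: k lekn lekj => [|k] lekn lekj /=; first by rewrite mulr0 mul0r.
by rewrite IH ?mulr0 // ltnW.
Qed.

(** A first bracket lands in the span of X_2, ..., X_n, which is abelian. *)
Lemma ad_X2_sqr x v : x 1%N = 0 ->
  sl_br (in_X x) (sl_br (in_X x) v) = 0.
Proof.
move=> x1; apply: slP => k.
- move=> /andP [_ lekn]; have lepn := leq_trans (leq_pred k) lekn.
  rewrite cX0 !(cX_br, cT_br) ?lekn ?lepn ?orbT //.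
  by rewrite !cX_in_X !cT_in_X x1 /=; ring.
- by rewrite cT_br cT0.
move=> /andP [_ lekm]; have lepm := leq_trans (leq_pred k) lekm.
rewrite cY0 !cY_br //.
by rewrite !(cX_br, cT_br) ?orbT // !cX_in_X !cT_in_X x1 !cY_in_X; ring.
Qed.

Lemma iter_ad_T t v j (w := iter j.+1 (sl_br (in_T t)) v) :
  [/\ forall k, (0 < k <= n)%N ->
        cX w k = (t 1%N * k%:R + t 2%N * (2 <= k)%N%:R) ^+ j.+1 * cX v k,
      forall k, cT w k = 0 &
      forall k, (0 < k <= m)%N ->
        cY w k = (t 1%N * k%:R + t 3%N) ^+ j.+1 * cY v k].
Proof.
rewrite {}/w; split=> [k /andP[_ lekn]|k|k /andP[_ lekm]].
- elim: j => [|j IH].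
    by rewrite cX_br ?lekn // !cX_in_T !cT_in_T /=; ring.
  by rewrite iterS cX_br ?lekn // IH [in RHS]exprS !cX_in_T !cT_in_T /=; ring.
- by rewrite iterS cT_br.
elim: j => [|j IH].
  by rewrite cY_br // !cX_in_T !cT_in_T !cY_in_T /=; ring.
by rewrite iterS cY_br // IH [in RHS]exprS !cX_in_T !cT_in_T !cY_in_T /=; ring.
Qed.

Lemma sl_even_split u : u.2 = 0 ->
  u = in_X (fun k => cX u 1 *+ (k == 1)%N)
    + in_X (fun k => cX u k *+ (1 < k)%N) + in_T (cT u).
Proof.
case: u => [[x t] y] /= ->; congr (_, _, _); apply/rowP => i; rewrite !mxE.
- rewrite addr0 (@cXE K n m (x, t, 0) i); case: (nat_of_ord i) => [|k] /=.
    by rewrite addr0.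
  by rewrite add0r.
- by rewrite !add0r -(@cTE K n m (x, t, 0) i).
- by rewrite !addr0.
Qed.

HB.instance Definition _ u := GRing.isLinear.Build K V V *:%R (@sl_br K n m u)
  (@sl_br_linearr K n m u).

(** An endomorphism ring is nontrivial only on a nonzero space; the T_k ensure
    this for all n and m. *)
Lemma dim_sl_gt0 : (0 < dim V)%N.
Proof.
have -> : dim V = (1 * n + 1 * 3 + 1 * m)%N by [].
by rewrite addn_gt0 addn_gt0 orbT.
Qed.

Definition sl_end : algType K := comp_alg dim_sl_gt0.

Lemma sl_end_mulE (f h : sl_end) v :
  ((f * h : sl_end) : 'End(V)) v = (f : 'End(V)) ((h : 'End(V)) v).
Proof. exact: comp_lfunE. Qed.

Lemma sl_end_expE (f : sl_end) k v :
  ((f ^+ k : sl_end) : 'End(V)) v = iter k (f : 'End(V)) v.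
Proof.
elim: k => [|k IH]; first by rewrite expr0; exact: id_lfunE.
by rewrite exprS sl_end_mulE IH.
Qed.

Local Notation V0 := ('rV[K]_n * 'rV[K]_3)%type.
Definition sl_ad (a : V0) : sl_end := (linfun (@sl_br K n m (a, 0)) : 'End(V)).

Lemma sl_adE a v : (sl_ad a : 'End(V)) v = sl_br (a, 0) v.
Proof. exact: lfunE. Qed.

Lemma sl_ad_is_linear : linear (sl_ad : sl_ev K n -> sl_end).
Proof.
move=> c a b; apply/lfunP => v.
transitivity (c *: (sl_ad a : 'End(V)) v + (sl_ad b : 'End(V)) v).
  rewrite !sl_adE -sl_br_linearl; congr (sl_br (_, _) v).
  by rewrite /= scaler0 addr0.
by rewrite -scale_lfunE -add_lfunE.
Qed.

HB.instance Definition _ := GRing.isLinear.Build K (sl_ev K n) sl_end *:%R sl_ad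
  sl_ad_is_linear.

Lemma sl_ad_br (a b : lie_ev (SL K n m)) :
  sl_ad (ev_br a b) = comm_br (sl_ad a) (sl_ad b).
Proof.
apply/lfunP => v.
transitivity
  (sl_br (a, 0) (sl_br (b, 0) v) - sl_br (b, 0) (sl_br (a, 0) v) : V).
  rewrite sl_adE sl_br_leibniz addrK /ev_br /=; congr (sl_br _ v).
  have : (sl_br (a, 0) (b, 0) : V).2 = 0.
    exact: (@sl_br_graded _ _ _ false false).
  by case: (sl_br _ _) => x y /= ->.
rewrite -(sl_adE b) -(sl_adE a (_ v)) -(sl_adE a v) -(sl_adE b (_ v)).
by rewrite -!sl_end_mulE -[in LHS]opp_lfunE -add_lfunE.
Qed.

End SLAdjoint.

(** * The p-th powers in SL *)

Section SLRestricted.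
Variables (K : fieldType) (p : nat).
Variables (p_gt2 : (2 < p)%N) (charK : p \in [pchar K]).
Variables (n m : nat).
Local Notation V := ('rV[K]_n * 'rV[K]_3 * 'rV[K]_m)%type.
Local Notation restrictable :=
  (@rho_restrictable K (SL K n m) (sl_end K n m) (@sl_ad K n m) p).

Let p_gt0 : (0 < p)%N := ltnW (ltnW p_gt2).

Lemma p_ge2E : p = p.-2.+2.
Proof. by case: p p_gt2 => [|[]]. Qed.

Lemma restrictable_X1 (c : K) : (m <= p)%N -> (n <= p.+1)%N ->
  restrictable (in_X n m (fun k => c *+ (k == 1)%N)).1.
Proof.
move=> lemp lenp; exists 0; rewrite linear0 eq_sym; apply/eqP/lfunP => v.
rewrite [RHS]zero_lfunE sl_end_expE (eq_iter (sl_adE _)) p_ge2E.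
have [wX wT wY] := iter_ad_X1 (n := n) (m := m) c v p.-2.
have p3 : p.-2.+3 = p.+1 by rewrite [in RHS]p_ge2E.
apply: slP => k; rewrite ?(cX0, cT0, cY0) ?wT //.
  by case/andP=> _ lekn; rewrite wX // p3 (leq_trans lekn).
by case/andP=> _ lekm; rewrite wY // -p_ge2E (leq_trans lekm).
Qed.

Lemma restrictable_X2 (x : nat -> K) : x 1%N = 0 -> restrictable (in_X n m x).1.
Proof.
move=> x1; exists 0; rewrite linear0 eq_sym; apply/eqP/lfunP => v.
rewrite [RHS]zero_lfunE sl_end_expE (eq_iter (sl_adE _)) p_ge2E.
rewrite !iterSr (ad_X2_sqr v x1).
by apply: iter_fix; exact: sl_br0.
Qed.

(** The shape of the eigenvalues of a combination of the T_i on X_k and Y_k. *)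
Lemma exp_pchar_weight (a b : K) (k : nat) :
  (a * k%:R + b) ^+ p = a ^+ p * k%:R + b ^+ p.
Proof.
rewrite -!(pFrobenius_autE charK) rmorphD rmorphM /=.
by rewrite pFrobenius_aut_nat.
Qed.

Lemma restrictable_T (t : nat -> K) : restrictable (in_T n m t).1.
Proof.
exists (in_T n m (fun k => t k ^+ p)).1; apply/eqP/lfunP => v.
rewrite sl_adE sl_end_expE (eq_iter (sl_adE _)) -[p in RHS](prednK p_gt0).
have [wX wT wY] := iter_ad_T (n := n) (m := m) t v p.-1.
have [zX zT zY] := iter_ad_T (n := n) (m := m) (fun k => t k ^+ p) v 0.
apply: slP => k.
- move=> kn; rewrite wX // [LHS]zX // expr1 prednK // exp_pchar_weight exprMn.
  by case: ltnP; rewrite ?expr1n ?expr0n ?gtn_eqF.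
- by rewrite wT [LHS]zT.
by move=> km; rewrite wY // [LHS]zY // expr1 prednK // exp_pchar_weight.
Qed.

(** * The two implications *)

Lemma SL_restricted : (1 < n)%N -> (0 < m)%N -> (m <= p)%N -> (n <= p.+1)%N ->
  has_p2p_structure (SL K n m) p.
Proof.
move=> n_gt1 m_gt0 lemp lenp.
apply: (@p2p_criterion K (SL K n m) (sl_end K n m) (@sl_ad K n m)
  (@sl_ad_br K n m) p charK (fun f v => (f : 'End(V)) v)).
- exact: id_lfunE.
- exact: sl_end_mulE.
- exact: sl_adE.
- apply: raddf_inj => a a0.
  have := sl_even_centralizer n_gt1 m_gt0 (u := (a, 0)) (erefl _).
  move=> /(_ _)/(congr1 fst) /=; apply => v.
  by rewrite -sl_adE a0; exact: zero_lfunE.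
move=> a; have := congr1 fst
  (sl_even_split (n := n) (m := m) (u := (a, 0)) (erefl _)).
rewrite [LHS]/= => ->; apply: rho_restrictableD => //; first exact: sl_ad_br.
  apply: rho_restrictableD => //; first exact: sl_ad_br.
    exact: restrictable_X1.
  by apply: restrictable_X2; rewrite mulr0n.
exact: restrictable_T.
Qed.

Lemma iter_ad_slX1_slY1 j : (0 < n)%N -> (j < m)%N ->
  cY (iter j (sl_br (slX K n m 1)) (slY K n m 1)) j.+1 = 1.
Proof.
move=> n_gt0; elim: j => [|j IH] ltjm; first by rewrite /= cY_slY ltjm mulr1.
rewrite iterS cY_br // IH 1?ltnW // cX_slX !cT_slX n_gt0 !cY_slX /=; ring.
Qed.

Lemma iter_ad_slX1_slX2 j : (j.+1 < n)%N ->
  cX (iter j (sl_br (slX K n m 1)) (slX K n m 2)) j.+2 = 1.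
Proof.
elim: j => [|j IH] ltjn; first by rewrite /= cX_slX ltjn mulr1.
have n_gt0 : (0 < n)%N by exact: leq_trans ltjn.
rewrite iterS cX_br ?ltjn //= IH ?(ltnW ltjn) //.
by rewrite !cX_slX !cT_slX n_gt0 /=; ring.
Qed.

(** The element z with ad z = (ad X_1)^p has no Y_(p+1)-coordinate in [z, Y_1]
    and no X_(p+2)-coordinate in [z, X_2], against the two lemmas above. *)
Lemma restricted_SL : (1 < n)%N ->
  has_p2p_structure (SL K n m) p -> (m <= p)%N /\ (n <= p.+1)%N.
Proof.
move=> n_gt1 [pmap [p2map [SR1 _ _ _]]]; have n_gt0 := ltnW n_gt1.
have {SR1} SR1 v := SR1 (slX K n m 1).1 v.
set z := pmap _ in SR1.
have p_neq1 : (p == 1)%N = false by rewrite gtn_eqF // ltnW.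
have p_neq0 : (p == 0)%N = false by rewrite gtn_eqF.
split; rewrite leqNgt; apply/negP => gtp; have /eqP := oner_neq0 K; apply.
  have <- := iter_ad_slX1_slY1 n_gt0 gtp.
  rewrite -[iter _ _ _]SR1 [X in cY X _]/= cY_br // !cY_slY.
  rewrite cX_slY !cT_slY !(@cY_ev K n m (ev_in z)) //=.
  by rewrite eqSS p_neq0 p_neq1 /=; ring.
have <- := iter_ad_slX1_slX2 gtp.
rewrite -[iter _ _ _]SR1 [X in cX X _]/= cX_br ?gtp // !cX_slX !cT_slX /=.
by rewrite !eqSS p_neq0 p_neq1 /=; ring.
Qed.
End SLRestricted.

Theorem theorem6p1 (K : fieldType) (p : nat) (p_pr : prime p) (p_gt2 : (2 < p)%N)
    (charK : p \in [pchar K]) (n m : nat) (n_gt1 : (1 < n)%N) (m_gt0 : (1 <= m)%N) :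
  has_p2p_structure (SL K n m) p <-> (m <= p)%N /\ (n <= p.+1)%N.
Proof.
split=> [|[lemp lenp]]; first exact: restricted_SL.
exact: SL_restricted.
Qed.
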